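(* Let $n\ge 2$, let $M\in\mathrm{GL}(n,\mathbb{Z})$, and let $P(x)=\det(x\mathbf{1}-M)$ be the characteristic polynomial of $M$. Suppose that $n$ is odd or $\det(M)=-1$. Then: (a) if $M$ is reversible in $\mathrm{GL}(n,\mathbb{Z})$, then $P(x)$ is reducible over $\mathbb{Z}$, and the spectrum of $M$ contains $1$ or $-1$; (b) if $P(x)$ is irreducible over $\mathbb{Z}$, then $M$ is not reversible in $\mathrm{GL}(n,\mathbb{Z})$.
   Context: $\mathrm{GL}(n,\mathbb{Z})$ is the group of integer $n\times n$ matrices with determinant $\pm1$. $M$ is reversible in $\mathrm{GL}(n,\mathbb{Z})$ if there is $G\in\mathrm{GL}(n,\mathbb{Z})$ with $GMG^{-1}=M^{-1}$. *)

(* Defs.v *)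
From HB Require Import structures.
From mathcomp Require Import all_boot all_order all_algebra all_field.

Set Implicit Arguments.
Unset Strict Implicit.
Unset Printing Implicit Defensive.

Import Order.TTheory GRing.Theory Num.Theory.
Local Open Scope ring_scope.

(* Irreducibility is taken in the ring-theoretic sense, to be used in
   {poly int}.  MathComp's [irreducible_poly] is defined by pseudo-division,
   which over int amounts to irreducibility over the rationals: there 2 *: 'X
   counts as irreducible. *)
Definition irreducible_in (R : idomainType) (p : R) : Prop :=
  [/\ p != 0, p \isn't a GRing.unit &
      forall q r : R, p = q * r -> q \is a GRing.unit \/ r \is a GRing.unit].

Definition reducible_in (R : idomainType) (p : R) : Prop :=
  p != 0 /\ exists q r : R,
    [/\ q \isn't a GRing.unit, r \isn't a GRing.unit & p = q * r].

(* The units of int are 1 and -1, so [unitmx] at int is GL(n, Z). *)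
Definition reversible_in_GLZ (n : nat) (M : 'M[int]_n) : Prop :=
  exists2 G : 'M[int]_n, G \in unitmx & G *m M *m invmx G = invmx M.

(* Complex eigenvalues of an integer matrix are algebraic, hence algC. *)
Definition spectrum (n : nat) (M : 'M[int]_n) : pred algC :=
  eigenvalue (map_mx intr M).

(* Main.v *)
Require Import Defs.
From HB Require Import structures.
From mathcomp Require Import all_boot all_order all_algebra all_field.

(** If G M G^-1 = M^-1 then M G M = G, so for c = 1 or c = -1
    M G (c - M) = c M G - G = - c (c - M) G.  Taking determinants,
    det M * P(c) = (- c)^n * P(c).  Hence P(-1) = 0 when det M = -1, and
    P(1) = 0 when det M = 1 and n is odd.  An integer root of P is an eigenvalue,
    and it splits off a linear factor, which is proper because deg P = n >= 2. *)

Set Implicit Arguments.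
Unset Strict Implicit.
Unset Printing Implicit Defensive.

Import Order.TTheory GRing.Theory Num.Theory.
Local Open Scope ring_scope.

(** Evaluation at [c] is a ring morphism, so it commutes with the determinant. *)
Lemma horner_char_poly (R : comNzRingType) (n : nat) (A : 'M[R]_n) (c : R) :
  (char_poly A).[c] = \det (c%:M - A).
Proof.
rewrite -[LHS]/(horner_eval c _) /char_poly -det_map_mx; congr (\det _).
apply/matrixP=> i j; rewrite !mxE /= /horner_eval.
by rewrite hornerD hornerN hornerC hornerMn hornerX.
Qed.

Lemma reversible_mulmx (n : nat) (M : 'M[int]_n) :
  M \in unitmx -> reversible_in_GLZ M ->
  exists2 G : 'M[int]_n, G \in unitmx & M *m G *m M = G.
Proof.
move=> uM [G uG e]; exists G => //.
have -> : M *m G *m M = M *m (G *m M *m invmx G) *m G.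
  by rewrite -!mulmxA mulVmx // mulmx1.
by rewrite e mulmxV // mul1mx.
Qed.

Lemma reversible_det_char_poly (R : comUnitRingType) (n : nat)
    (M G : 'M[R]_n) (c : R) :
  G \in unitmx -> M *m G *m M = G -> c * c = 1 ->
  \det M * (char_poly M).[c] = (- c) ^+ n * (char_poly M).[c].
Proof.
rewrite unitmxE horner_char_poly => uG e cc.
have /(congr1 determinant) :
    M *m G *m (c%:M - M) = - c *: ((c%:M - M) *m G).
  (* As [c * c = 1], the term [G] is [c * c *: G], which lets [- c] factor out. *)
  rewrite mulmxBr e mul_mx_scalar mulmxBl mul_scalar_mx scalerBr scalerA.
  by rewrite mulNr cc !scaleNr opprK scale1r addrC.
rewrite detZ !det_mulmx => ed; apply: (mulIr uG).
by rewrite mulrAC ed mulrA.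
Qed.

Lemma reversible_root_char_poly (n : nat) (M : 'M[int]_n) :
  M \in unitmx -> odd n \/ \det M = -1 -> reversible_in_GLZ M ->
  root (char_poly M) 1 \/ root (char_poly M) (-1).
Proof.
move=> uM hodd /(reversible_mulmx uM) [G uG e].
have key := reversible_det_char_poly uG e.
have [dM|dM] := eqVneq (\det M) (-1).
  (* For [c = -1] the factor [(- c) ^+ n] is [1], so [key] gives [- P(-1) = P(-1)], forcing zero in
     [int]. *)
  right; have := key (-1) erefl.
  by rewrite dM opprK expr1n mul1r mulN1r => /eqP; rewrite eqNr.
case: hodd => [on|/eqP]; last by rewrite (negbTE dM).
left; have := key 1 erefl.
have -> : \det M = 1.
  (* [\det M] is a unit of [int], and [dM] excludes [-1]. *)
  by move: uM dM; rewrite unitmxE unfold_in /= => /orP[/eqP-> //|->].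
by rewrite -signr_odd on expr1 mul1r mulN1r => /esym/eqP; rewrite eqNr.
Qed.

(** Units of [{poly R}] are constants, of size 1. The factor ['X - c%:P] has size 2, and its
    cofactor has size one less than [p], hence at least 2. *)
Lemma root_reducible (R : idomainType) (p : {poly R}) (c : R) :
  (2 < size p)%N -> root p c -> reducible_in p.
Proof.
move=> sp /factor_theorem [q pE].
have p0 : p != 0 by rewrite -size_poly_gt0 (leq_trans _ sp).
split=> //; exists q, ('X - c%:P); split=> //; rewrite poly_unitE.
  have q0 : q != 0 by apply: contraNneq p0 => q0; rewrite pE q0 mul0r.
  move: sp; rewrite pE size_Mmonic ?monicXsubC // size_XsubC addn2 /= ltnS.
  by case: eqP => // ->.
by rewrite size_XsubC.
Qed.

(** The characteristic polynomial commutes with the embedding of [int] in [algC], which preserves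
    roots. *)
Lemma root_char_poly_spectrum (n : nat) (M : 'M[int]_n) (c : int) :
  root (char_poly M) c -> c%:~R \in spectrum M.
Proof.
rewrite -[_ \in _]/(eigenvalue _ _) eigenvalue_root_char -map_char_poly.
exact: rmorph_root.
Qed.

Lemma irreducible_not_reducible (R : idomainType) (p : R) :
  irreducible_in p -> ~ reducible_in p.
Proof.
move=> [_ _ h] [_ [q [r [nq nr /h [uq|ur]]]]].
  by rewrite uq in nq.
by rewrite ur in nr.
Qed.

Theorem proposition3 (n : nat) (M : 'M[int]_n)
    (hn : (2 <= n)%N) (hM : M \in unitmx)
    (hodd : odd n \/ \det M = -1) :
  (reversible_in_GLZ M ->
     reducible_in (char_poly M) /\ (1 \in spectrum M \/ -1 \in spectrum M)) /\
  (irreducible_in (char_poly M) -> ~ reversible_in_GLZ M).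
Proof.
have a : reversible_in_GLZ M ->
    reducible_in (char_poly M) /\ (1 \in spectrum M \/ -1 \in spectrum M).
  (* The size is [n.+1], so this is [hn]. *)
  have sp : (2 < size (char_poly M))%N by rewrite size_char_poly.
  move=> /(reversible_root_char_poly hM hodd) [] r;
    split; try exact: root_reducible sp r.
    (* [1%:~R] and [(-1)%:~R] compute to [1] and [-1] in [algC]. *)
    by left; apply: root_char_poly_spectrum r.
  by right; apply: root_char_poly_spectrum r.
by split=> // irr /a [red _]; apply: irreducible_not_reducible red.
Qed.
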